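(* For $I\subseteq N$, $|I|=k$, define $$\Psi_I=\sum_{\substack{F\in\mathcal F_{q-k+1}\\ N\setminus I\text{ is a spanning tree of }H_F}}w(F),\qquad \Psi_\varnothing:=\Phi_{\mathrm{valid}}.$$ Then the principal minors of the superport response matrix $L$ satisfy $$\det L[I,I]=\frac{\Psi_I}{\Phi_{\mathrm{valid}}}.$$
   Context: Network. $G=(V,E)$ is a finite connected simple undirected graph; each edge $e$ has a conductance $c_e\in\mathbb R_{>0}$. The weighted Laplacian $L_c$ is the $V\times V$ matrix with $(L_c)_{uu}=\sum_{e\ni u}c_e$, $(L_c)_{uv}=-c_{uv}$ if $uv\in E$, and $0$ otherwise. A spanning forest $F$ of $G$ is an acyclic subgraph with vertex set $V$ (isolated vertices allowed); $w(F)=\prod_{e\in F}c_e$; $\mathcal F_m$ is the set of spanning forests with exactly $m$ connected components. Matrix conventions. $A[S,T]$ is the submatrix with rows $S$ and columns $T$ in inherited order; empty determinants equal $1$. Superports. The boundary $M\subseteq V$ is nonempty and partitioned into nonempty superports $M=A_1\sqcup\cdots\sqcup A_p$. Choose a root $r_a\in A_a$ for each $a$; $R=\{r_1,\dots,r_p\}$, $N=M\setminus R$, $q=|N|$, $N=(x_1,\dots,x_q)$ in a fixed order; $r(x)$ is the root of the superport containing $x$. Superport response. Given $y\in\mathbb R^N$, consider voltages $U\in\mathbb R^V$ with $U_x-U_{r(x)}=y_x$ for all $x\in N$ whose incoming-current vector $\iota=L_cU$ satisfies $\iota_v=0$ for $v\notin M$ and $\sum_{v\in A_a}\iota_v=0$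 for every $a$. Put $j_x=\iota_x$ for $x\in N$ (the independent incoming currents). The linear map $y\mapsto j$ is the superport response and $L$ is its $q\times q$ matrix: $j=Ly$. Valid forests. A spanning forest is valid if identifying all boundary vertices within each superport (one vertex per superport) turns it into a spanning tree of the quotient network (loops and parallel edges count as cycles). $\Phi_{\mathrm{valid}}=\sum_{F\text{ valid}}w(F)$. Quotient port graph. For a spanning forest $F$, the quotient port multigraph $H_F$ has the connected components of $F$ as vertices, and each $x\in N$ gives a directed edge from the component containing $r(x)$ to the component containing $x$ (a loop if these coincide); subsets of $N$ are thereby regarded as edge sets of $H_F$. *)

(* Defs.v *)
From HB Require Import structures.
From mathcomp Require Import all_boot all_order all_algebra.
From mathcomp Require Import ring lra.
Set Implicit Arguments. Unset Strict Implicit. Unset Printing Implicit Defensive.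
Import Order.TTheory GRing.Theory Num.Theory.
Local Open Scope ring_scope.

(* Undirected multigraphs, loops and parallel edges allowed: [joins H e u v]
   says that u and v are the two (possibly equal) ends of the edge e.  Edge
   sets are passed separately, as finite sets over the edge type ET. *)
Record multigraph (VT ET : finType) := Multigraph {
  vertices : {set VT};
  joins : ET -> rel VT
}.

Section Multigraph.
Variables (VT ET : finType) (H : multigraph VT ET) (F : {set ET}).

Definition adj : rel VT := fun u v => [exists e in F, joins H e u v].

(* The sequence (v_1,e_1), ..., (v_k,e_k) with k >= 1, where e_i joins v_i and
   v_(i+1) and e_k joins v_k and v_1.  A loop is a cycle with k = 1, two
   parallel edges form one with k = 2. *)
Definition is_cycle (s : seq (VT * ET)) : bool :=
  [&& s != [::], uniq (unzip1 s), uniq (unzip2 s), all (mem F) (unzip2 s)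
    & cycle (fun a b => joins H a.2 a.1 b.1) s].

(* The bound on the length only makes this decidable, see acyclicP. *)
Definition acyclic : bool :=
  [forall k : 'I_#|ET|, forall s : (k.+1).-tuple (VT * ET), ~~ is_cycle s].

Lemma acyclicP : reflect (forall s, ~~ is_cycle s) acyclic.
Proof.
apply: (iffP forallP) => [acF s | acF k]; last by apply/forallP => s; apply: acF.
apply/negP => cyc_s; have /and5P[s0 _ u2 _ _] := cyc_s.
have lt_s : ((size s).-1 < #|ET|)%N.
  rewrite prednK ?lt0n ?size_eq0 //.
  by rewrite -(size_map snd) -(card_uniqP u2) max_card.
have sz_s : size s == (size s).-1.+1 by rewrite prednK ?lt0n ?size_eq0.
by have /forallP/(_ (Tuple sz_s))/negP := acF (Ordinal lt_s); apply.
Qed.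

Definition connected : bool :=
  [forall u in vertices H, forall v in vertices H, connect adj u v].

Definition spanning_tree : bool := connected && acyclic.

End Multigraph.

Section Network.
Variables (R : realFieldType) (V : finType).
(* A simple graph on V is given by its set E of edges, each a 2-element set;
   c gives the conductances (only the values on E matter). *)
Variables (E : {set {set V}}) (c : {set V} -> R).

Definition simple_graph : Prop := {in E, forall e : {set V}, #|e| = 2}.

Definition network_graph : multigraph V {set V} :=
  Multigraph setT (fun e u v => e == [set u; v]).

Definition laplacian (u v : V) : R :=
  if u == v then \sum_(e in E | u \in e) c e
  else if [set u; v] \in E then - c [set u; v] else 0.

Definition current (U : V -> R) (v : V) : R := \sum_u laplacian v u * U u.

Definition weight (F : {set {set V}}) : R := \prod_(e in F) c e.

Definition component (F : {set {set V}}) (v : V) : {set V} :=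
  [set u | connect (adj network_graph F) v u].

Definition components (F : {set {set V}}) : {set {set V}} :=
  [set component F v | v : V].

Definition spanning_forest (F : {set {set V}}) : bool :=
  (F \subset E) && acyclic network_graph F.

Definition forests (m : nat) : {set {set {set V}}} :=
  [set F | spanning_forest F & #|components F| == m].

(* The superports are the blocks of P, a partition of the boundary M, and
   [root A] is the chosen root of the superport A. *)
Variables (M : {set V}) (P : {set {set V}}) (root : {set V} -> V).

Definition root_of (x : V) : V := root (pblock P x).

Definition ports : {set V} := M :\: [set root A | A in P].

Definition quotient_vertex (v : V) : {set V} :=
  if v \in M then pblock P v else [set v].

Definition quotient_graph : multigraph {set V} {set V} :=
  Multigraph [set quotient_vertex v | v : V]
    (fun e a b => [exists u, exists v,
       [&& e == [set u; v], a == quotient_vertex u & b == quotient_vertex v]]).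

Definition valid (F : {set {set V}}) : bool :=
  spanning_forest F && spanning_tree quotient_graph F.

Definition Phi_valid : R := \sum_(F | valid F) weight F.

(* H_F without its orientation, which plays no role for spanning trees; its
   edges are the elements of [ports]. *)
Definition port_graph (F : {set {set V}}) : multigraph {set V} V :=
  Multigraph (components F)
    (fun x a b =>
       (a == component F (root_of x)) && (b == component F x)
    || (a == component F x) && (b == component F (root_of x))).

Definition Psi (I : {set V}) : R :=
  if I == set0 then Phi_valid
  else \sum_(F in forests (#|ports| - #|I| + 1) |
               spanning_tree (port_graph F) (ports :\: I)) weight F.

Variables (q : nat) (xs : q.-tuple V).

Definition admissible (y : 'cV[R]_q) (U : V -> R) : Prop :=
  [/\ forall i, U (tnth xs i) - U (root_of (tnth xs i)) = y i 0,
      forall v, v \notin M -> current U v = 0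
    & {in P, forall A : {set V}, \sum_(v in A) current U v = 0}].

(* The graph of y |-> j is the graph of the linear map with matrix L; such an
   L exists by superport_response_exists below. *)
Definition superport_response (L : 'M[R]_q) : Prop :=
  forall y j : 'cV[R]_q,
    (exists2 U, admissible y U & j = \col_i current U (tnth xs i))
    <-> j = L *m y.

(* L[I,I]; enum_val enumerates the indices in increasing order. *)
Definition port_indices (I : {set V}) : {set 'I_q} :=
  [set i | tnth xs i \in I].

Definition principal_submx (L : 'M[R]_q) (I : {set V}) :
    'M[R]_#|port_indices I| :=
  mxsub (@enum_val _ (mem (port_indices I)))
        (@enum_val _ (mem (port_indices I))) L.

End Network.

Section Existence.
Variables (R : realFieldType) (V : finType).
Variables (E : {set {set V}}) (c : {set V} -> R).
Hypothesis simpleE : simple_graph E.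
Hypothesis connE : connected (network_graph V) E.
Hypothesis c_gt0 : {in E, forall e, 0 < c e}.

Let w (u v : V) : R := if [set u; v] \in E then c [set u; v] else 0.

Let wC u v : w u v = w v u. Proof. by rewrite /w setUC. Qed.

Let w_ge0 u v : 0 <= w u v.
Proof. by rewrite /w; case: ifP => // /c_gt0/ltW. Qed.

Let edge_neq u v : [set u; v] \in E -> u != v.
Proof. by move/simpleE; rewrite cards2; case: (u != v). Qed.

Let degreeE v : \sum_(e in E | v \in e) c e = \sum_u w v u.
Proof.
rewrite /w -big_mkcond /=.
transitivity (\sum_(e in [set [set v; u] | u in [set u | [set v; u] \in E]]) c e).
  apply: eq_bigl => e; apply/idP/imsetP => [/andP[eE ve] | [u]]; last first.
    by rewrite inE => uE ->; rewrite uE !inE eqxx.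
  have /eqP/cards2P[a [b [ab eab]]] := simpleE eE.
  move: ve eE; rewrite eab !inE => /orP[/eqP-> | /eqP->] abE.
    by exists b; rewrite ?inE.
  by exists a; rewrite ?inE setUC.
rewrite big_imset /=; first by apply: eq_bigl => u; rewrite inE.
move=> a b; rewrite !inE => /edge_neq va /edge_neq vb /setP/(_ a).
by rewrite !inE eqxx orbT eq_sym (negPf va) => /esym/eqP.
Qed.

Lemma currentE U v : current E c U v = \sum_u w v u * (U v - U u).
Proof.
under [RHS]eq_bigr do rewrite mulrBr.
rewrite sumrB -mulr_suml -degreeE /current (bigD1 v) //= /laplacian eqxx.
congr (_ + _); rewrite [in RHS](bigD1 v) //=.
have -> : w v v = 0 by rewrite /w; case: ifP => // /edge_neq; rewrite eqxx.
rewrite mul0r add0r -sumrN; apply: eq_bigr => u; rewrite eq_sym => /negPf->.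
by rewrite /w; case: ifP => _; rewrite ?mulNr // !mul0r oppr0.
Qed.

Lemma energy_eq0 U : \sum_v U v * current E c U v = 0 -> forall u v, U u = U v.
Proof.
move=> S0.
have S1 : \sum_v \sum_u U v * (w v u * (U v - U u)) = 0.
  by rewrite -[RHS]S0; apply: eq_bigr => v _; rewrite currentE mulr_sumr.
have S2 : \sum_v \sum_u U u * (w v u * (U u - U v)) = 0.
  rewrite exchange_big -[RHS]S1 /=.
  by apply: eq_bigr => v _; apply: eq_bigr => u _; rewrite (wC u v).
have T0 : \sum_v \sum_u w v u * (U v - U u) ^+ 2 = 0.
  have := congr2 +%R S1 S2; rewrite addr0 -big_split /= => S12.
  rewrite -[RHS]S12; apply: eq_bigr => v _; rewrite -big_split /=.
  by apply: eq_bigr => u _; ring.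
have T_ge0 v u : 0 <= w v u * (U v - U u) ^+ 2 by rewrite mulr_ge0 ?sqr_ge0.
have T_eq0 v u : w v u * (U v - U u) ^+ 2 = 0.
  have := psumr_eq0P (fun v _ => sumr_ge0 _ (fun u _ => T_ge0 v u)) T0.
  by move=> /(_ v isT) /(psumr_eq0P (fun u _ => T_ge0 v u)); apply.
have edgeU u v : adj (network_graph V) E u v -> U u = U v.
  case/existsP=> e /= /andP[eE /eqP def_e]; apply/eqP; rewrite -subr_eq0.
  move/eqP: (T_eq0 u v); rewrite /w -def_e eE mulf_eq0 sqrf_eq0.
  by rewrite gt_eqF ?c_gt0.
move=> u v; have /forall_inP/(_ u (in_setT _))/forall_inP := connE.
move=> /(_ v (in_setT _)) /connectP[s s_path ->].
elim: s u s_path => //= a s IHs u /andP[/edgeU-> /IHs]; exact.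
Qed.

Variables (M : {set V}) (P : {set {set V}}) (root : {set V} -> V).
Hypothesis M_neq0 : M != set0.
Hypothesis partP : partition P M.
Hypothesis rootP : {in P, forall A : {set V}, root A \in A}.
Variables (q : nat) (xs : q.-tuple V).
Hypothesis uniq_xs : uniq xs.
Hypothesis mem_xs : xs =i ports M P root.

Let adm := @admissible R V E c M P root q xs.

Let blockP x : x \in M -> pblock P x \in P.
Proof. by rewrite -(cover_partition partP); apply: pblock_mem. Qed.

Let block_eq A x : A \in P -> x \in A -> pblock P x = A.
Proof. by have [_ tiP _] := and3P partP; apply: def_pblock. Qed.

Let subM A x : A \in P -> x \in A -> x \in M.
Proof.
by move=> PA Ax; rewrite -(cover_partition partP); apply/bigcupP; exists A.
Qed.

Let portE x : (x \in ports M P root) = (x \in M) && (x != root_of P root x).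
Proof.
rewrite inE andbC; apply: andb_id2l => Mx; congr (~~ _); apply/imsetP/eqP.
  by case=> A PA ->; rewrite /root_of (block_eq PA) ?rootP.
by move=> def_x; exists (pblock P x); rewrite ?blockP.
Qed.

Lemma admissible0 U : adm 0 U -> forall u v, U u = U v.
Proof.
case=> U1 U2 U3; apply: energy_eq0.
rewrite (bigID (mem M)) /= addrC big1 ?add0r => [|v /U2->]; last exact: mulr0.
rewrite -(cover_partition partP) big_trivIset /=; last by case/and3P: partP.
apply: big1 => A PA.
rewrite -[RHS](mulr0 (U (root A))) -[in RHS](U3 A PA) mulr_sumr.
apply: eq_bigr => v Av; congr (_ * _).
have [Nv|] := boolP (v \in ports M P root).
  rewrite -mem_xs in Nv; have /tnthP[i def_v] := Nv.
  have /eqP := U1 i; rewrite mxE subr_eq0 -def_v /root_of (block_eq PA) //.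
  by move/eqP.
by rewrite portE (subM PA Av) negbK /root_of (block_eq PA Av) => /eqP <-.
Qed.

Let current_lin (I : finType) (a : I -> R) (U : I -> V -> R) v :
  current E c (fun u => \sum_i a i * U i u) v = \sum_i a i * current E c (U i) v.
Proof.
rewrite /current; under eq_bigr do rewrite mulr_sumr.
rewrite exchange_big; apply: eq_bigr => i _; rewrite mulr_sumr.
by apply: eq_bigr => u _; rewrite mulrCA.
Qed.

Let currentB U U' v :
  current E c (fun u => U u - U' u) v = current E c U v - current E c U' v.
Proof. by rewrite -sumrB; apply: eq_bigr => u _; rewrite mulrBr. Qed.

Let current_sum U : \sum_v current E c U v = 0.
Proof.
under eq_bigr do rewrite currentE.
set S := LHS; have : S + S = 0; last by move=> ?; lra.
rewrite {1}/S exchange_big -big_split big1 // => v _ /=.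
rewrite -big_split big1 // => u _ /=; rewrite wC; ring.
Qed.

Lemma admissible_exists y : exists U, adm y U.
Proof.
have /set0Pn[m0 Mm0] := M_neq0; pose rt := root_of P root; pose r0 := rt m0.
pose Pm := pblock P m0.
pose lap := laplacian E c.
pose g v u : R := if v \notin M then lap v u
  else if v != rt v then (u == v)%:R - (u == rt v)%:R
  else if v == r0 then (u == v)%:R
  else \sum_(a in pblock P v) lap a u.
have gE v U : \sum_u g v u * U u = if v \notin M then current E c U v
    else if v != rt v then U v - U (rt v)
    else if v == r0 then U v
    else \sum_(a in pblock P v) current E c U a.
  have pick x : \sum_u (u == x)%:R * U u = U x.
    rewrite (bigD1 x) //= eqxx mul1r big1 ?addr0 // => u /negPf->.
    exact: mul0r.
  rewrite /g; case: ifP => _ //; case: ifP => _.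
    by under eq_bigr do rewrite mulrBl; rewrite sumrB !pick.
  case: ifP => _ //; rewrite exchange_big; apply: eq_bigr => u _ /=.
  by rewrite mulr_suml.
have rtA A : A \in P -> rt (root A) = root A.
  by move=> PA; rewrite /rt /root_of (block_eq PA) ?rootP.
have admP (z : 'cV[R]_q) (U : V -> R) :
    (forall i, U (tnth xs i) - U (rt (tnth xs i)) = z i 0) ->
    (forall v, v \notin M -> \sum_u g v u * U u = 0) ->
    (forall v, v \in M -> v = rt v -> \sum_u g v u * U u = 0) -> adm z U.
  move=> U1 U2 U3.
  have sumA A : A \in P -> A != Pm -> \sum_(v in A) current E c U v = 0.
    move=> PA neA; have Mr := subM PA (rootP PA).
    have := U3 _ Mr (esym (rtA A PA)); rewrite gE Mr /= (rtA A PA) eqxx /=.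
    rewrite (block_eq PA) ?rootP //; case: eqP => // eq_r.
    case/negP: neA; apply/eqP; have PPm := blockP Mm0.
    by rewrite -(block_eq PA (rootP PA)) eq_r (block_eq PPm) // rootP.
  have out v : v \notin M -> current E c U v = 0.
    by move=> nMv; have := U2 v nMv; rewrite gE nMv.
  split=> // A PA; have [eqA | /sumA] := eqVneq A Pm; last exact.
  have := current_sum U; rewrite (bigID (mem M)) /= addrC big1 // add0r.
  rewrite -(cover_partition partP) big_trivIset; last by case/and3P: partP.
  rewrite /= (bigD1 A) //= [X in _ + X]big1 ?addr0 // => B /andP[PB neB].
  by apply: sumA; rewrite // -eqA.
pose n := #|V|; pose B : 'M[R]_n := \matrix_(i, j) g (enum_val i) (enum_val j).
pose fn (z : 'cV[R]_n) v := z (enum_rank v) 0.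
have BE z v : \sum_u g v u * fn z u = (B *m z) (enum_rank v) 0.
  rewrite mxE (reindex (@enum_val V (mem V))) /=; last first.
    exact/onW_bij/enum_val_bij.
  by apply: eq_bigr => j _; rewrite mxE enum_rankK /fn enum_valK.
have xsM i : tnth xs i \in M /\ tnth xs i != rt (tnth xs i).
  by apply/andP; rewrite -portE -mem_xs mem_tnth.
have uB : B \in unitmx.
  rewrite -unitmx_tr -row_free_unit -kermx_eq0; apply/rowV0P => z /sub_kermxP.
  move/(congr1 trmx); rewrite trmx_mul trmxK trmx0 => Bz.
  have g0 v : \sum_u g v u * fn z^T u = 0 by rewrite BE Bz mxE.
  have cst : forall u v, fn z^T u = fn z^T v.
    apply: admissible0; apply: admP => // i; rewrite mxE -[RHS](g0 (tnth xs i)).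
    by rewrite gE; have [-> ->] := xsM i.
  have Mr0 : r0 \in M by apply: (subM (blockP Mm0)); apply: rootP; apply: blockP.
  have := g0 r0; rewrite gE Mr0 /= (rtA _ (blockP Mm0)) !eqxx /= => z0.
  apply/rowP => k; rewrite mxE -[RHS]z0 -(cst (enum_val k)).
  by rewrite /fn mxE enum_valK.
pose b : 'cV[R]_n := \col_k \sum_(i | tnth xs i == enum_val k) y i 0.
have sol v : \sum_u g v u * fn (invmx B *m b) u = \sum_(i | tnth xs i == v) y i 0.
  by rewrite BE mulKVmx // mxE enum_rankK.
exists (fn (invmx B *m b)); apply: admP => [i|v nMv|v Mv rv].
- have := sol (tnth xs i); rewrite gE; have [-> ->] /= := xsM i.
  move=> ->; rewrite (bigD1 i) //= big1 ?addr0 // => k /andP[/eqP eqk].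
  by rewrite -(inj_eq (tuple_uniqP xs uniq_xs)) eqk eqxx.
- by rewrite sol big1 // => i /eqP eqv; have [] := xsM i; rewrite eqv (negPf nMv).
- by rewrite sol big1 // => i /eqP eqv; have [] := xsM i; rewrite eqv -rv eqxx.
Qed.

Lemma superport_response_exists :
  exists L, superport_response E c M P root xs L.
Proof.
have [U admU] : exists U : 'I_q -> V -> R, forall k, adm (delta_mx k 0) (U k).
  exact: (fin_all_exists (fun k => admissible_exists (delta_mx k 0))).
pose L : 'M[R]_q := \matrix_(i, k) current E c (U k) (tnth xs i).
exists L => y j; pose Uy v := \sum_k y k 0 * U k v.
have LyE : L *m y = \col_i current E c Uy (tnth xs i).
  apply/colP => i; rewrite !mxE current_lin; apply: eq_bigr => k _.
  by rewrite mxE mulrC.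
have admUy : adm y Uy.
  split=> [i | v nMv | A PA].
  - rewrite -sumrB (bigD1 i) //= -mulrBr; have [-> _ _] := admU i.
    rewrite mxE !eqxx mulr1 big1 ?addr0 // => k ki; rewrite -mulrBr.
    by have [-> _ _] := admU k; rewrite mxE eq_sym (negPf ki) mulr0.
  - by rewrite current_lin big1 // => k _; have [_ -> //] := admU k; rewrite mulr0.
  - under eq_bigr do rewrite current_lin.
    rewrite exchange_big big1 // => k _; rewrite -mulr_sumr.
    by have [_ _ ->] := admU k; rewrite ?mulr0.
split=> [[U' admU' ->] | ->]; last by exists Uy.
rewrite LyE; apply/colP => i; rewrite !mxE; apply/eqP; rewrite -subr_eq0 -currentB.
have cst : forall u v, U' u - Uy u = U' v - Uy v.
  apply: (@admissible0 (fun v => U' v - Uy v)).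
  case: admU' => a1 a2 a3; case: admUy => b1 b2 b3.
  split=> [k | v nMv | A PA].
  - by rewrite mxE -[RHS](subrr (y k 0)) -{1}a1 -b1; ring.
  - by rewrite currentB a2 // b2 // subr0.
  - under eq_bigr do rewrite currentB.
    by rewrite sumrB a3 // b3 // subr0.
rewrite currentE; apply/eqP; apply: big1 => u _.
by rewrite (cst _ u) subrr mulr0.
Qed.

End Existence.

(* Main.v *)
(* Use the coordinates [z x = U x - U (r x)] at the ports and [z v = U v] at the
   other vertices, with one root r0 grounded.  In these coordinates the
   Laplacian becomes a form K; writing W for the vertices other than r0 and the
   ports, the admissibility conditions read [(K z) w = 0] for w in W, and the
   independent currents are [(K z) x] for x in N.  So L is the Schur complement
   of K[W] in K[N u W], and det L[I,I] = det K[I u W] / det K[W].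
     By Cauchy-Binet, det K[I u W] is the sum of w(F) (det D_F)^2 over the edge
   sets F with |F| = |I u W|, where D_F is the incidence matrix of F in these
   coordinates.  If F together with the edges r(x)-x, x in N \ I, connects V,
   paths from r0 give an integral left inverse of D_F, so (det D_F)^2 = 1;
   otherwise the indicator of the vertices not connected to r0 is a kernel
   vector.  Counting components, these F are the forests of Psi_I, and for
   I = 0 the valid forests. *)
Require Import Defs.
From mathcomp Require Import all_boot all_order all_fingroup all_algebra.
Set Implicit Arguments. Unset Strict Implicit. Unset Printing Implicit Defensive.
Import Order.TTheory GRing.Theory Num.Theory.
Local Open Scope ring_scope.

(** * Determinants *)

(** Multilinearity in the rows: [f] chooses one summand of each row. *)
Lemma det_expand_rows (R : comPzRingType) (T : finType) m
    (a : 'I_m -> T -> R) (B : T -> 'I_m -> R) :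
  \det (\matrix_(i, j) \sum_e a i e * B e j) =
  \sum_(f : {ffun 'I_m -> T})
     (\prod_i a i (f i)) * \det (\matrix_(i, j) B (f i) j).
Proof.
transitivity (\sum_(s : 'S_m) \sum_(f : {ffun 'I_m -> T})
    (-1) ^+ s * \prod_i (a i (f i) * B (f i) (s i))).
  apply: eq_bigr => s _; rewrite -mulr_sumr; congr (_ * _).
  under eq_bigr do rewrite mxE.
  exact: (bigA_distr_bigA (fun i e => a i e * B e (s i))).
rewrite exchange_big; apply: eq_bigr => f _; rewrite mulr_sumr.
apply: eq_bigr => s _; rewrite big_split mulrCA; congr (_ * (_ * _)).
by apply: eq_bigr => i _; rewrite mxE.
Qed.

(** A choice of summands that is not injective repeats a row and contributes 0. The injective
    choices are grouped by their image [F]; each is the enumeration of [F] after a permutation, and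
    these permutations give the Leibniz sum of the first factor. The default [t0] is never returned,
    since [F] has [m] elements. *)
Lemma Cauchy_Binet (R : comPzRingType) (T : finType) (t0 : T) m
    (a : 'I_m -> T -> R) (B : T -> 'I_m -> R) :
  \det (\matrix_(i, j) \sum_e a i e * B e j) =
  \sum_(F : {set T} | #|F| == m)
     \det (\matrix_(i, j) a i (nth t0 (enum F) j)) *
     \det (\matrix_(i, j) B (nth t0 (enum F) i) j).
Proof.
rewrite det_expand_rows //.
rewrite (bigID (fun f : {ffun 'I_m -> T} => injectiveb f)) /= addrC.
rewrite big1 => [|f]; last first.
  move=> /injectivePn[i [j ij fij]]; rewrite (determinant_alternate ij) ?mulr0 //.
  by move=> k; rewrite !mxE fij.
rewrite add0r (partition_big (fun f : {ffun 'I_m -> T} => f @: setT)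
  (fun F => #|F| == m)); last first.
  by move=> f /injectiveP injf; rewrite card_imset // cardsT card_ord.
apply: eq_bigr => F /eqP cF.
pose g (i : 'I_m) := nth t0 (enum F) i.
have szF : size (enum F) = m by rewrite -cardE.
have gF i : g i \in F by rewrite -mem_enum mem_nth ?szF.
have injg : injective g.
  move=> i j /eqP; rewrite nth_uniq ?szF ?enum_uniq // => /eqP; exact: val_inj.
have imF (x : T) : x \in F -> (index x (enum F) < m)%N.
  by rewrite -szF index_mem mem_enum.
pose h (s : 'S_m) : {ffun 'I_m -> T} := [ffun i => g (s i)].
transitivity (\sum_(s : 'S_m)
    (\prod_i a i (h s i)) * \det (\matrix_(i, j) B (h s i) j)).
  rewrite (reindex h) /=.
    apply: eq_bigl => s; apply/andP; split.
      by apply/injectiveP => i j; rewrite !ffunE => /injg/perm_inj.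
    rewrite eqEcard cF card_imset ?cardsT ?card_ord ?leqnn ?andbT; last first.
      by move=> i j; rewrite !ffunE => /injg/perm_inj.
    by apply/subsetP => _ /imsetP[i _ ->]; rewrite ffunE.
  have injh : injective h.
    move=> s t /ffunP hst; apply/permP => i; apply: injg.
    by have := hst i; rewrite !ffunE.
  (* The default permutation is a filler: every injective [f] with image [F] is some [h s]. *)
  exists (fun f => odflt 1%g [pick s | h s == f]) => [s _ | f].
    by case: pickP => [t /eqP/injh // | /(_ s)]; rewrite eqxx.
  rewrite inE => /andP[/injectiveP injf /eqP imf].
  case: pickP => [t /eqP // | noh].
  have fF i : f i \in F by rewrite -imf imset_f.
  pose s0 i := Ordinal (imF _ (fF i)).
  have gs0 i : g (s0 i) = f i by rewrite /g nth_index ?mem_enum.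
  have inj_s0 : injective s0 by move=> i j sij; apply: injf; rewrite -!gs0 sij.
  by have /eqP[] := noh (perm inj_s0); apply/ffunP => i; rewrite ffunE permE gs0.
rewrite [X in _ = X * _]/determinant mulr_suml. apply: eq_bigr => s _.
rewrite -[RHS]mulrA mulrCA; congr (_ * _).
  by apply: eq_bigr => i _; rewrite !mxE ffunE.
(* Permuting the rows of the second minor by [s] costs the sign that the Leibniz sum supplies. *)
rewrite -det_perm -det_mulmx -row_permE; congr (\det _).
by apply/matrixP => i j; rewrite !mxE ffunE.
Qed.

(** Two enumerations differ by a permutation of rows and columns alike, so its sign occurs twice. *)
Lemma det_bij (R : comPzRingType) (T : finType) (g : T -> T -> R) N
    (b b' : 'I_N -> T) :
  bijective b -> bijective b' ->
  \det (\matrix_(i, j) g (b i) (b j)) = \det (\matrix_(i, j) g (b' i) (b' j)).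
Proof.
move=> [c bK cK] bij_b'; have [c' b'K c'K] := bij_b'.
have inj_s : injective (c \o b') by apply: inj_comp (can_inj cK) (can_inj b'K).
pose s := perm inj_s.
have -> : \matrix_(i, j) g (b' i) (b' j) =
    row_perm s (col_perm s (\matrix_(i, j) g (b i) (b j))).
  by apply/matrixP => i j; rewrite !mxE !permE /= !cK.
rewrite row_permE col_permE !det_mulmx !det_perm odd_permV mulrCA.
by rewrite -signr_addb addbb mulr1.
Qed.

(* By [det_bij] any other enumeration of T gives the same value. *)
Definition fdet (R : comPzRingType) (T : finType) (g : T -> T -> R) : R :=
  \det (\matrix_(i < #|T|, j < #|T|) g (enum_val i) (enum_val j)).

Lemma eq_fdet (R : comPzRingType) (T : finType) (f g : T -> T -> R) :
  f =2 g -> fdet f = fdet g.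
Proof. by move=> fg; congr (\det _); apply/matrixP=> i j; rewrite !mxE. Qed.

Lemma fdet_mul (R : comPzRingType) (T : finType) (f g : T -> T -> R) :
  fdet f * fdet g = fdet (fun u v => \sum_w f u w * g w v).
Proof.
rewrite -det_mulmx; congr (\det _); apply/matrixP=> i j; rewrite !mxE.
rewrite (reindex (@enum_val T (mem T))) /=; last exact/onW_bij/enum_val_bij.
by apply: eq_bigr => k _; rewrite !mxE.
Qed.

Lemma fdet_delta (R : comPzRingType) (T : finType) :
  fdet (fun u v : T => (u == v)%:R) = 1 :> R.
Proof.
rewrite -[RHS](det1 _ #|T|); congr (\det _); apply/matrixP=> i j.
by rewrite !mxE (inj_eq enum_val_inj).
Qed.

Lemma fdet_inverse (R : fieldType) (T : finType) (g : T -> T -> R) :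
  (forall z : T -> R, (forall u, \sum_v g u v * z v = 0) -> z =1 (fun=> 0)) ->
  exists z : T -> T -> R, forall u v, \sum_w g u w * z w v = (u == v)%:R.
Proof.
move=> ker0; pose B := \matrix_(i < #|T|, j < #|T|) g (enum_val i) (enum_val j).
have sumE (z : T -> R) u : \sum_w g u w * z w =
      \sum_(k < #|T|) g u (enum_val k) * z (enum_val k).
  by rewrite (reindex (@enum_val T (mem T))) /=; last exact/onW_bij/enum_val_bij.
have uB : B \in unitmx.
  rewrite unitmxE unitfE -det_tr; apply/negP => /det0P[y y0 yB].
  case/eqP: y0; apply/rowP => k; rewrite mxE.
  have := ker0 (fun u => y 0 (enum_rank u)) _ (enum_val k).
  rewrite enum_valK; apply=> u.
  have /rowP/(_ (enum_rank u)) := yB; rewrite !mxE => {2}<-; rewrite sumE.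
  by apply: eq_bigr => i _; rewrite !mxE enum_rankK enum_valK mulrC.
exists (fun u v => invmx B (enum_rank u) (enum_rank v)) => u v.
have /matrixP/(_ (enum_rank u) (enum_rank v)) := mulmxV uB.
rewrite !mxE (inj_eq enum_rank_inj) => <-; rewrite sumE.
by apply: eq_bigr => k _; rewrite mxE enum_rankK enum_valK.
Qed.

(** With the elements of [S] listed first, the matrix is block upper triangular with an identity
    block. Minors on different sets [S] thus become determinants over one index type, and [fdet_mul]
    applies to them. *)
Lemma fdet_rows (R : comPzRingType) (T : finType) (g : T -> T -> R) (S : {set T})
    m (h : 'I_m -> T) :
  injective h -> (forall x, (x \in S) = (x \in codom h)) ->
  fdet (fun u v => if u \in S then g u v else (u == v)%:R) =
  \det (\matrix_(i, j) g (h i) (h j)).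
Proof.
move=> injh imh; set gS := (X in fdet X).
have cS : #|S| = m.
  by rewrite (eq_card imh) card_codom ?card_ord.
pose h' (k : 'I_#|~: S|) : T := enum_val k.
pose b (i : 'I_(m + #|~: S|)) : T :=
  match split i with inl a => h a | inr k => h' k end.
have hS i : h i \in S by rewrite imh codom_f.
have h'S k : h' k \notin S by have := enum_valP k; rewrite inE.
have cT : (m + #|~: S|)%N = #|T| by rewrite -cS cardsC.
have bij_b : bijective b.
  apply: inj_card_bij; last by rewrite card_ord cT.
  move=> i j; rewrite /b -{2}(splitK i) -{2}(splitK j).
  case: (split i) => a; case: (split j) => k; rewrite /unsplit.
  - by move/injh->.
  - by move=> eq_ak; have := h'S k; rewrite -eq_ak hS.
  - by move=> eq_ak; have := h'S a; rewrite eq_ak hS.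
  - by move/enum_val_inj->.
have fdetb N (d : 'I_N -> T) (f : T -> T -> R) : bijective d ->
    fdet f = \det (\matrix_(i, j) f (d i) (d j)).
  move=> bij_d; have eN : N = #|T| by rewrite -(bij_eq_card bij_d) card_ord.
  by subst N; apply: det_bij bij_d; apply: enum_val_bij.
rewrite (fdetb _ _ _ bij_b).
set A := (X in _ = \det X).
have -> : \matrix_(i, j) gS (b i) (b j) =
    block_mx A (\matrix_(i, j) g (h i) (h' j)) 0 1%:M.
  apply/matrixP => i j; rewrite -(splitK i) -(splitK j).
  case: (split i) => a; case: (split j) => k;
    rewrite /unsplit !(block_mxEul, block_mxEur, block_mxEdl, block_mxEdr) mxE /b
      !(unsplitK (inl _), unsplitK (inr _)) /gS ?hS ?(negPf (h'S _)) !mxE //.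
    by case: eqP => // eq_ak; have := h'S a; rewrite eq_ak hS.
  by rewrite (inj_eq enum_val_inj).
by rewrite det_ublock det1 mulr1.
Qed.

(** * Components and cycles of a multigraph *)

Section CycleRank.
Variables (VT ET : finType) (H : multigraph VT ET).
Implicit Types (F : {set ET}) (e : ET).

(* Multigraphs allow edges with no ends or several pairs of ends; here each edge
   has one pair of ends. *)
Definition proper_edges F : Prop := forall e, e \in F -> exists a b,
  [/\ a \in vertices H, b \in vertices H
    & forall x y, joins H e x y = (x == a) && (y == b) || (x == b) && (y == a)].

Definition comps F : {set {set VT}} :=
  [set [set y | connect (adj H F) x y] | x in vertices H].

Lemma proper_edgesS F F' : F \subset F' -> proper_edges F' -> proper_edges F.
Proof. by move=> /subsetP sFF' wf e /sFF'/wf. Qed.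

Lemma adj_sym F : proper_edges F -> symmetric (adj H F).
Proof.
move=> wf x y; apply: eq_existsb => e; apply: andb_id2l => /wf[a [b [_ _ ends]]].
by rewrite !ends orbC ![(x == _) && _]andbC.
Qed.

Lemma adj_connect_sym F : proper_edges F -> connect_sym (adj H F).
Proof. by move=> /adj_sym symF; apply: sym_connect_sym. Qed.

(** A walk that crosses [e] several times can be shortened to cross it at most once. *)
Lemma connectU1 F e a b :
  (forall x y, joins H e x y = (x == a) && (y == b) || (x == b) && (y == a)) ->
  forall x y, connect (adj H (e |: F)) x y =
    [|| connect (adj H F) x y, connect (adj H F) x a && connect (adj H F) b y
      | connect (adj H F) x b && connect (adj H F) a y].
Proof.
move=> ends x y; apply/idP/idP => [/connectP[p] | ].
  elim: p x => [|z p IHp] x /=; first by move=> _ ->; rewrite connect0.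
  case/andP=> /existsP[f /andP[]]; rewrite !inE => /orP[/eqP-> | Ff].
    rewrite ends => /orP[]/andP[/eqP-> /eqP->] /IHp{IHp}IH /IH;
    by case/or3P=> [->|/andP[_ ->]|/andP[_ ->]]; rewrite !connect0 ?orbT.
  move=> fxz /IHp{IHp}IH /IH.
  have xz : connect (adj H F) x z by apply/connect1/existsP; exists f; rewrite Ff.
  by case/or3P=> [/(connect_trans xz)-> | /andP[/(connect_trans xz)-> ->]
    | /andP[/(connect_trans xz)-> ->]]; rewrite ?orbT.
have sub u v : connect (adj H F) u v -> connect (adj H (e |: F)) u v.
  apply: connect_sub => {}u {}v /existsP[f /andP[Ff fuv]].
  by apply/connect1/existsP; exists f; rewrite inE Ff orbT.
have cab : connect (adj H (e |: F)) a b.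
  by apply/connect1/existsP; exists e; rewrite setU11 ends !eqxx.
have cba : connect (adj H (e |: F)) b a.
  by apply/connect1/existsP; exists e; rewrite setU11 ends !eqxx orbT.
case/or3P=> [/sub//|/andP[/sub xa /sub by_]|/andP[/sub xb /sub ay]].
  exact: connect_trans xa (connect_trans cab by_).
exact: connect_trans xb (connect_trans cba ay).
Qed.

(** [e] merges the components of [a] and [b] if they differ, and otherwise changes no component. *)
Lemma card_compsU1 F e a b :
  proper_edges F -> a \in vertices H -> b \in vertices H ->
  (forall x y, joins H e x y = (x == a) && (y == b) || (x == b) && (y == a)) ->
  #|comps F| = (#|comps (e |: F)| + ~~ connect (adj H F) a b)%N.
Proof.
move=> wf Xa Xb ends; have cC := adj_connect_sym wf.
pose C x := [set y | connect (adj H F) x y].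
have CE x y : (C x == C y) = connect (adj H F) x y.
  apply/eqP/idP => [/setP/(_ y) | xy]; first by rewrite !inE connect0.
  by apply/setP=> z; rewrite !inE (same_connect cC xy).
have cU := connectU1 F ends.
have [ab | nab] /= := boolP (connect (adj H F) a b).
  rewrite addn0; congr #|pred_of_set _|; apply: eq_imset => x; apply/setP=> y.
  rewrite !inE cU; have [//|nxy] := boolP (connect _ x y).
  apply/idP/idP=> //= /orP[]/andP[xa by_]; case/negP: nxy.
    exact: connect_trans xa (connect_trans ab by_).
  by apply: connect_trans xa (connect_trans _ by_); rewrite cC.
have -> : comps (e |: F) = (C a :|: C b) |: (comps F :\: [set C a; C b]).
  have C'E x : [set y | connect (adj H (e |: F)) x y] =
      if connect (adj H F) a x || connect (adj H F) b x then C a :|: C b else C x.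
    rewrite !(cC _ x); case: ifP => [/orP[xa|xb] | /norP[nxa nxb]]; apply/setP=> y;
      rewrite !inE cU.
    - rewrite xa !(same_connect cC xa) /=.
      by rewrite (negPf nab) orbF.
    - rewrite xb !(same_connect cC xb) /= [connect _ b a]cC (negPf nab) /=.
      exact: orbC.
    - by rewrite (negPf nxa) (negPf nxb) orbF.
  apply/setP=> A; apply/imsetP/setU1P => [[x Xx ->] | [-> | ]].
  - rewrite C'E; case: ifP => [_ | /negbT/norP[nax nbx]]; [by left | right].
    by rewrite !inE !CE ![connect _ x _]cC (negPf nax) (negPf nbx) imset_f.
  - by exists a; rewrite // C'E connect0.
  - case/setDP=> /imsetP[x Xx ->]; rewrite !inE !CE ![connect _ x _]cC => /negPf nx.
    by exists x; rewrite // C'E nx.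
have sab : [set C a; C b] \subset comps F.
  by apply/subsetP=> A; rewrite !inE => /orP[]/eqP->; apply: imset_f.
rewrite cardsU1 (cardsD (comps F)) (setIidPr sab) cards2 CE nab /=.
have := subset_leq_card sab; rewrite cards2 CE nab /=.
(* An old component other than [C a] and [C b] does not contain [a], so it is not their union. *)
suff -> : C a :|: C b \notin comps F :\: [set C a; C b].
  by case: #|comps F| => [|[|k]] //= _; rewrite subn2 /= add1n addn1.
apply/negP => /setDP[/imsetP[x Xx defC]]; rewrite -/(C x) in defC.
rewrite defC !inE !CE => /norP[nxa _].
by case/negP: nxa; have /setP/(_ a) := defC; rewrite !inE connect0 => <-.
Qed.

Lemma card_comps0 : #|comps set0| = #|vertices H|.
Proof.
have c0 x y : connect (adj H set0) x y = (x == y).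
  apply/idP/eqP => [/connectP[[|z p] //=] | ->]; last exact: connect0.
  by case/andP=> /existsP[e]; rewrite inE.
apply: card_imset => x y /setP/(_ y); rewrite !inE !c0 eqxx; exact/eqP.
Qed.

(** Deleting an edge adds at most one component, and without edges every vertex is a component. *)
Lemma card_vertices_le F : proper_edges F -> (#|vertices H| <= #|F| + #|comps F|)%N.
Proof.
have [n] := ubnP #|F|; elim: n F => // n IHn F ltFn wf.
have [-> | [e Fe]] := set_0Vmem F; first by rewrite card_comps0 leq_addl.
have [a [b [Xa Xb ends]]] := wf e Fe.
have wf' : proper_edges (F :\ e) by apply: proper_edgesS wf; apply: subD1set.
have := card_compsU1 wf' Xa Xb ends; rewrite setD1K // => cF.
have := cardsD1 e F; rewrite Fe => cFe; rewrite cFe in ltFn *.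
have := IHn (F :\ e) ltFn wf'; rewrite cF => /leq_trans; apply.
by rewrite addnA -[leqRHS]addnA [leqRHS]addnC leq_add2l leq_b1.
Qed.

Lemma acyclicS F F' : F \subset F' -> acyclic H F' -> acyclic H F.
Proof.
move=> /subsetP sFF' /acyclicP acF'; apply/acyclicP => s.
apply: contra (acF' s) => /and5P[s0 u1 u2 Fs cs].
rewrite /is_cycle s0 u1 u2 cs andbT /=.
by apply: sub_all Fs => e /sFF'.
Qed.

(** Each vertex of a simple path is paired with an edge to the next one, and the last vertex with
    [e]. The final clause carries the induction: later edges of [F] have both ends on the rest of
    the path, while the edge at [x] has the end [x], so no edge repeats. *)
Lemma path_closing_cycle F e x p : proper_edges F -> e \notin F ->
  path (adj H F) x p -> uniq (x :: p) ->
  exists a s, [/\ map fst (a :: s) = x :: p,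
    uniq (map snd (a :: s)), path (fun a b => joins H a.2 a.1 b.1) a s,
    (last a s).2 = e
  & {in map snd (a :: s), forall f, f = e \/ f \in F /\
      exists u v, [/\ u \in x :: p, v \in x :: p & joins H f u v]}].
Proof.
move=> wf nFe; elim: p x => [|y p IHp] x /=.
  by move=> _ _; exists (x, e), [::]; split=> //= f; rewrite inE => /eqP; left.
case/andP=> /existsP[f /andP[Ff fxy]] py /andP[nxp up].
have [[a1 a2] [s [[def_a def_p] us ps ls es]]] := IHp y py up.
exists (x, f), ((a1, a2) :: s); split=> //=.
- by rewrite def_a def_p.
- move: (us) => /= ->; rewrite andbT.
  apply/negP => /es[def_f | [_ [u [v [pu pv fuv]]]]].
    by rewrite def_f (negPf nFe) in Ff.
  have [c [d [_ _ ends]]] := wf f Ff; move: fxy fuv; rewrite !ends.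
  have neqx w : w \in y :: p -> (x == w) = false.
    by move=> pw; apply: contraNF nxp => /eqP->.
  have xu := neqx u pu; have xv := neqx v pv.
  by case/orP=> /andP[/eqP ex _] /orP[]/andP[/eqP eu /eqP ev];
    rewrite ex eu ev eqxx in xu xv.
- by rewrite ps andbT def_a.
- move=> g; rewrite /= in_cons.
  case/predU1P=> [-> | /es[-> | [Fg [u [v [pu pv guv]]]]]]; [right | by left | right].
    by split=> //; exists x, y; rewrite !inE !eqxx orbT.
  by split=> //; exists u, v; rewrite in_cons pu [v \in _]in_cons pv !orbT.
Qed.

(** A simple path from [a] to [b] in [F] would be closed to a cycle by [e]. *)
Lemma acyclic_disconnect F e a b : proper_edges (e |: F) -> e \notin F ->
  joins H e b a -> acyclic H (e |: F) -> ~~ connect (adj H F) a b.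
Proof.
move=> wf nFe eba acF; apply/negP => /connectP[p0 p0P def_b].
case/shortenP: p0P def_b => p pP up _ def_b.
have wfF : proper_edges F by apply: proper_edgesS wf; apply: subsetUr.
have [x [s [def_p us ps ls es]]] := path_closing_cycle wfF nFe pP up.
have/acyclicP/(_ (x :: s))/negP[] := acF; rewrite /is_cycle; apply/and5P; split=> //.
- by rewrite /unzip1 def_p.
- apply/allP=> f /es[-> | [Ff _]]; first exact: setU11.
  exact: setU1r.
rewrite /= rcons_path ps ls.
have -> : (last x s).1 = b.
  by rewrite -[LHS](last_map fst) def_b; case: def_p => -> ->.
by case: def_p => -> _.
Qed.

(** In an acyclic set every deletion of an edge splits a component, so [card_vertices_le] becomes an
    equality. *)
Lemma card_forest F : proper_edges F -> acyclic H F ->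
  #|vertices H| = (#|F| + #|comps F|)%N.
Proof.
have [n] := ubnP #|F|; elim: n F => // n IHn F ltFn wf acF.
have [-> | [e Fe]] := set_0Vmem F; first by rewrite card_comps0 cards0.
have [a [b [Xa Xb ends]]] := wf e Fe.
have sF := subD1set F e; have wf' := proper_edgesS sF wf.
have nab : ~~ connect (adj H (F :\ e)) a b.
  apply: (@acyclic_disconnect _ e); rewrite ?setD1K //; first by rewrite !inE eqxx.
  by rewrite ends !eqxx orbT.
have := card_compsU1 wf' Xa Xb ends; rewrite setD1K // nab addn1 => cF.
have := cardsD1 e F; rewrite Fe => cFe; rewrite cFe in ltFn *.
by rewrite (IHn _ ltFn wf' (acyclicS sF acF)) cF addnS add1n addSn.
Qed.

(** An edge [e] on a cycle can be deleted without changing the components, and then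
    [card_vertices_le] for [F :\ e] contradicts the bound. *)
Lemma card_acyclic F : proper_edges F -> (#|F| + #|comps F| <= #|vertices H|)%N ->
  acyclic H F.
Proof.
move=> wf leFX; apply/acyclicP => s; apply: contraL leFX => /and5P[s0 _ us Fs cs].
rewrite -ltnNge; case: s s0 us Fs cs => // -[x e] s _ /=.
case/andP=> nse us /andP[Fe /allP Fs] cs.
have [a [b [Xa Xb ends]]] := wf e Fe.
have sF := subD1set F e; have wf' := proper_edgesS sF wf.
have cC := adj_connect_sym wf'.
have ab : connect (adj H (F :\ e)) a b.
  have {nse us} Fs f : f \in map snd s -> f \in F :\ e.
    move=> sf; rewrite !inE [f \in F](Fs f sf) andbT.
    by apply: contraNneq nse => <-.
  (* The cycle without [e] is a walk from [y] back to [x]. *)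
  have walk y g t : path (fun a b => joins H a.2 a.1 b.1) (y, g) (rcons t (x, e)) ->
      (forall f, f \in map snd ((y, g) :: t) -> f \in F :\ e) ->
      connect (adj H (F :\ e)) y x.
    elim: t y g => [|[z h] t IHt] y g /=; rewrite ?andbT.
      by move=> gyx Fg; apply/connect1/existsP; exists g; rewrite Fg ?inE ?gyx.
    case/andP=> gyz tP Ft; apply: (@connect_trans _ _ z).
      by apply/connect1/existsP; exists g; rewrite Ft ?inE ?eqxx ?gyz.
    by apply: IHt tP _ => f tf; apply: Ft; rewrite inE tf orbT.
  (* If nothing is left besides [e], the cycle is a loop and its ends [a] and [b] coincide. *)
  case: s cs Fs => [|[y g] s] /=; rewrite ?andbT ?ends.
    by case/orP=> /andP[/eqP <- /eqP <-].
  case/andP=> exy /walk cyx /cyx {cyx}.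
  by case/orP: exy=> /andP[/eqP-> /eqP->] //; rewrite cC.
have := card_compsU1 wf' Xa Xb ends; rewrite setD1K // ab addn0 => <-.
by rewrite (cardsD1 e) Fe add1n addSn ltnS card_vertices_le.
Qed.

Lemma card_comps_connected F : proper_edges F -> vertices H != set0 ->
  connected H F -> #|comps F| = 1%N.
Proof.
move=> wf /set0Pn[x Xx] /forall_inP cF; have cC := adj_connect_sym wf.
apply/eqP/cards1P; exists [set y | connect (adj H F) x y].
apply/setP=> A; rewrite inE; apply/imsetP/eqP => [[y Xy ->] | ->]; last by exists x.
by apply/setP=> z; rewrite !inE (same_connect cC (forall_inP (cF x Xx) y Xy)).
Qed.

End CycleRank.

(** * Forests, port graphs and quotients *)

(** A path in the image is lifted step by step; since the fibres of [f] are connected by [r], the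
    representative can be changed between two steps. An edge of [r] may be contracted by [f], hence
    [connect] in the first hypothesis. *)
Lemma connect_image (T T' : finType) (f : T -> T') (r : rel T) (r' : rel T') :
  (forall x y, r x y -> connect r' (f x) (f y)) ->
  (forall x y, f x = f y -> connect r x y) ->
  (forall x b, r' (f x) b ->
     exists x' y', [/\ f x' = f x, f y' = b & connect r x' y']) ->
  forall x y, connect r x y = connect r' (f x) (f y).
Proof.
move=> rr' fib lift x y; apply/idP/idP => [/connectP[p] | /connectP[p]].
  elim: p x => [|z p IHp] x /=; first by move=> _ ->; apply: connect0.
  by case/andP=> /rr' xz /IHp{IHp}IH /IH; apply: connect_trans.
elim: p x => [|b p IHp] x /=; first by move=> _ /esym/fib.
case/andP=> /lift[x' [y' [/esym/fib xx' <- x'y']]] /IHp{IHp}IH /IH.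
by apply: connect_trans; apply: connect_trans xx' x'y'.
Qed.

Lemma connected_image (T T' ET : finType) (f : T -> T') (r : rel T)
    (H : multigraph T' ET) (F : {set ET}) :
  vertices H = [set f x | x : T] ->
  (forall x y, connect r x y = connect (adj H F) (f x) (f y)) ->
  connected H F = [forall x, forall y, connect r x y].
Proof.
move=> XE cE; apply/forall_inP/forallP => [cH x | cr a].
  have X z : f z \in vertices H by rewrite XE; apply: imset_f.
  by apply/forallP => y; rewrite cE; apply: (forall_inP (cH _ (X x))).
rewrite XE => /imsetP[x _ ->]; apply/forall_inP => _ /imsetP[y _ ->].
by rewrite -cE (forallP (cr x)).
Qed.

Lemma eq_set2 (T : finType) (a b x y : T) :
  ([set a; b] == [set x; y]) = (x == a) && (y == b) || (x == b) && (y == a).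
Proof.
apply/eqP/orP => [/setP eqs | [/andP[/eqP-> /eqP->] | /andP[/eqP-> /eqP->]]] //;
  last exact: setUC.
have Ha := eqs a; have Hb := eqs b; have Hx := eqs x; have Hy := eqs y.
rewrite !inE !eqxx ?orbT /= in Ha Hb Hx Hy.
case/orP: Hx => /eqP ex; case/orP: Hy => /eqP ey; rewrite ex ey ?eqxx in Ha Hb *.
- by move: Hb; rewrite orbb eq_sym => <-; left.
- by left.
- by right.
- by move: Ha; rewrite orbb eq_sym => <-; left.
Qed.

Section Forests.
Variables (R : realFieldType) (V : finType) (E : {set {set V}}) (c : {set V} -> R).
Hypothesis simpleE : simple_graph E.
Variables (M : {set V}) (P : {set {set V}}) (root : {set V} -> V).
Hypothesis M_neq0 : M != set0.
Hypothesis partP : partition P M.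
Hypothesis rootP : {in P, forall A : {set V}, root A \in A}.

Notation N := (ports M P root).
Notation rt := (root_of P root).

Lemma pblock_block A x : A \in P -> x \in A -> pblock P x = A.
Proof. by have [_ tiP _] := and3P partP; apply: def_pblock. Qed.

Lemma block_boundary A x : A \in P -> x \in A -> x \in M.
Proof. by move=> PA Ax; rewrite -(cover_partition partP); apply/bigcupP; exists A. Qed.

Lemma pblockP x : x \in M -> pblock P x \in P.
Proof. by rewrite -(cover_partition partP); apply: pblock_mem. Qed.

Lemma root_of_root A : A \in P -> rt (root A) = root A.
Proof. by move=> PA; rewrite /root_of (pblock_block PA) ?rootP. Qed.

Lemma root_of_mem x : x \in M -> rt x \in pblock P x.
Proof. by move=> Mx; apply/rootP/pblockP. Qed.

Lemma root_of_boundary x : x \in M -> rt x \in M.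
Proof. by move=> Mx; apply: block_boundary (root_of_mem Mx); apply: pblockP. Qed.

Lemma portE x : (x \in N) = (x \in M) && (x != rt x).
Proof.
rewrite inE andbC; apply: andb_id2l => Mx; congr (~~ _); apply/imsetP/eqP.
  by case=> A PA ->; rewrite root_of_root.
by move=> def_x; exists (pblock P x); rewrite ?pblockP.
Qed.

Lemma root_of_portN x : x \in M -> rt x \notin N.
Proof. by move=> Mx; rewrite portE root_of_root ?eqxx ?andbF ?pblockP. Qed.

(** A common model on [V] for both quotients: contracting the edges of [F] gives the port graph,
    contracting the port edges with [J] equal to all ports gives the quotient by superports. *)
Definition joined (F : {set {set V}}) (J : {set V}) : rel V := fun x y =>
  adj (network_graph V) F x y ||
  [exists z in J, (x == z) && (y == rt z) || (x == rt z) && (y == z)].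

Definition joined_connected F J := [forall x, forall y, connect (joined F J) x y].

Implicit Types (F : {set {set V}}) (J : {set V}).

Lemma joined_forest F J x y : connect (adj (network_graph V) F) x y ->
  connect (joined F J) x y.
Proof. by apply: connect_sub => u v uv; rewrite connect1 // /joined uv. Qed.

Lemma network_proper F : F \subset E -> proper_edges (network_graph V) F.
Proof.
move=> /subsetP sFE e /sFE/simpleE/eqP/cards2P[a [b [_ ->]]]; exists a, b.
by split=> [||x y]; rewrite ?inE //= eq_set2.
Qed.

Lemma joined_sym F J : F \subset E -> connect_sym (joined F J).
Proof.
move=> /network_proper/adj_sym symF; apply: sym_connect_sym => x y.
congr (_ || _); first exact: symF.
apply: eq_existsb => z; apply: andb_id2l => _.
by rewrite orbC ![(x == _) && _]andbC.
Qed.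

Lemma comps_network F : comps (network_graph V) F = components F.
Proof. by apply/setP=> A; apply/imsetP/imsetP => -[x _ ->]; exists x; rewrite ?inE. Qed.

Lemma component_eq F x y : F \subset E ->
  (component F x == component F y) = connect (adj (network_graph V) F) x y.
Proof.
move=> /network_proper/adj_connect_sym cC.
apply/eqP/idP => [/setP/(_ y) | xy]; first by rewrite !inE connect0.
by apply/setP=> z; rewrite !inE (same_connect cC xy).
Qed.

Lemma port_graph_proper F J : J \subset N -> proper_edges (port_graph P root F) J.
Proof.
move=> sJ e Je; exists (component F (rt e)), (component F e).
by split=> //; apply: imset_f.
Qed.

(** The fibres of [component F] are connected through [F], so [connect_image] applies. *)
Lemma port_graph_connected F J : F \subset E ->
  connected (port_graph P root F) J = joined_connected F J.
Proof.
move=> sFE; apply: (@connected_image _ _ _ (component F)) => //.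
apply: connect_image => [x y /orP[xy | /exists_inP[z Jz]] | x y | x b].
- have /eqP-> : component F x == component F y by rewrite component_eq // connect1.
  exact: connect0.
- move=> xyz; apply/connect1/exists_inP; exists z => //=.
  by case/orP: xyz => /andP[/eqP-> /eqP->]; rewrite !eqxx ?orbT.
- by move/eqP; rewrite component_eq //; apply: joined_forest.
- case/exists_inP=> z Jz /orP[]/andP[/eqP xz /eqP->].
    exists (rt z), z; split=> //; apply/connect1/orP; right.
    by apply/exists_inP; exists z; rewrite // !eqxx orbT.
  exists z, (rt z); split=> //; apply/connect1/orP; right.
  by apply/exists_inP; exists z; rewrite // !eqxx.
Qed.

(** * The quotient by superports and the count of its vertices *)

Notation qv := (quotient_vertex M P).

Lemma quotient_root x : x \in M -> qv (rt x) = qv x.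
Proof.
move=> Mx; rewrite /quotient_vertex Mx root_of_boundary //.
exact: pblock_block (pblockP Mx) (root_of_mem Mx).
Qed.

Lemma joined_root F x : x \in M -> connect (joined F N) x (rt x).
Proof.
move=> Mx; have [<- | neq] := eqVneq x (rt x); first exact: connect0.
apply/connect1/orP; right; apply/exists_inP; exists x; rewrite ?eqxx //.
by rewrite portE Mx.
Qed.

Lemma joined_of_root F x : x \in M -> connect (joined F N) (rt x) x.
Proof.
move=> Mx; have [<- | neq] := eqVneq x (rt x); first exact: connect0.
apply/connect1/orP; right; apply/exists_inP; exists x; rewrite ?eqxx ?orbT //.
by rewrite portE Mx.
Qed.

Lemma quotient_eq x y : qv x = qv y -> x = y \/ [/\ x \in M, y \in M & rt x = rt y].
Proof.
have memb z : z \in M -> z \in pblock P z by rewrite mem_pblock (cover_partition partP).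
rewrite /quotient_vertex; case: ifP => Mx; case: ifP => My.
- by move=> eqb; right; rewrite /root_of eqb.
- by move=> /setP/(_ x); rewrite memb // inE => /esym/eqP; left.
- by move=> /setP/(_ y); rewrite memb // inE => /eqP; left.
- by move/set1_inj; left.
Qed.

(** The nontrivial fibres of [qv] are superports, and these are connected through their roots by
    port edges. *)
Lemma quotient_connected F : F \subset E ->
  connected (quotient_graph M P) F = joined_connected F N.
Proof.
move=> sFE; apply: (@connected_image _ _ _ qv) => //.
apply: connect_image => [x y /orP[/exists_inP[e Fe xy] | /exists_inP[z Nz]] | x y | x b].
- apply/connect1/exists_inP; exists e => //=.
  by apply/existsP; exists x; apply/existsP; exists y; rewrite !eqxx !andbT.
- have Mz : z \in M by case/setDP: Nz.
  by case/orP=> /andP[/eqP-> /eqP->]; rewrite quotient_root ?connect0.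
- case/quotient_eq=> [-> | [Mx My eq_rt]]; first exact: connect0.
  by apply: connect_trans (joined_root F Mx) _; rewrite eq_rt joined_of_root.
- case/exists_inP=> e Fe /existsP[u /existsP[v /and3P[/eqP def_e /eqP-> /eqP->]]].
  exists u, v; split=> //; apply/joined_forest/connect1/exists_inP.
  by exists e; rewrite //= def_e eqxx.
Qed.

Lemma quotient_proper F : F \subset E -> proper_edges (quotient_graph M P) F.
Proof.
move=> /subsetP sFE e /sFE/simpleE/eqP/cards2P[a [b [_ ->]]]; exists (qv a), (qv b).
split=> [||A B] /=; try exact: imset_f.
apply/existsP/orP => [[u /existsP[v]] | ].
  rewrite eq_set2 => /and3P[/orP[]/andP[/eqP-> /eqP->] -> ->]; first by left.
  by right.
case=> /andP[/eqP-> /eqP->].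
  by exists a; apply/existsP; exists b; rewrite !eqxx.
by exists b; apply/existsP; exists a; rewrite !eqxx setUC eqxx.
Qed.

(** Every quotient vertex has exactly one representative that is not a port: a root or a vertex off
    the boundary. *)
Lemma card_quotient : (#|vertices (quotient_graph M P)| + #|N| = #|V|)%N.
Proof.
rewrite -(cardsC N) addnC; congr addn.
have -> : vertices (quotient_graph M P) = [set qv x | x in ~: N].
  apply/setP=> A; apply/imsetP/imsetP => -[x Nx ->]; last by exists x.
  have [Nx' | nNx] := boolP (x \in N); last by exists x; rewrite ?in_setC.
  have Mx : x \in M by case/setDP: Nx'.
  by exists (rt x); rewrite ?quotient_root // in_setC root_of_portN.
apply: card_in_imset => x y; rewrite !in_setC !portE => nx ny.
case/quotient_eq=> // -[Mx My].
by move: nx ny; rewrite Mx My !negbK => /eqP <- /eqP <-.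
Qed.

(* Says that F, together with the edges x-(rt x) for x in J, is a spanning tree
   of V, without mentioning cycles. *)
Definition completes F J :=
  [&& F \subset E, (#|F| + #|J| + 1 == #|V|)%N & joined_connected F J].

Lemma components_neq0 F : components F != set0.
Proof.
have /set0Pn[m _] := M_neq0; apply/set0Pn.
by exists (component F m); apply: imset_f.
Qed.

(** Connectedness of the port graph bounds the number of components by [#|J| + 1] from above, the
    edge count of [F] bounds it from below. Equality makes [F] acyclic by [card_acyclic]. *)
Lemma completes_card F J : J \subset N -> completes F J ->
  spanning_forest E F && (#|components F| == #|J| + 1)%N.
Proof.
move=> sJ /and3P[sFE /eqP cV cFJ].
have pF := network_proper sFE; have pJ := port_graph_proper F sJ.
rewrite -(port_graph_connected _ sFE) in cFJ.
have leC := card_vertices_le pJ.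
rewrite (card_comps_connected pJ (components_neq0 F) cFJ) /= in leC.
have geC := card_vertices_le pF.
rewrite comps_network /= cardsT -cV -addnA leq_add2l in geC.
have eqC : #|components F| = (#|J| + 1)%N by apply/eqP; rewrite eqn_leq leC.
rewrite eqC eqxx andbT /spanning_forest sFE /=; apply: card_acyclic => //.
by rewrite comps_network eqC /= cardsT -cV addnA.
Qed.

(** Acyclicity is traded for edge counts, by [card_forest] in one direction and [card_acyclic] in
    the other. *)
Lemma port_treeE F J : J \subset N ->
  (F \in forests E (#|J| + 1)) && spanning_tree (port_graph P root F) J =
  completes F J.
Proof.
move=> sJ; rewrite inE; apply/idP/idP => [|cFJ].
  case/andP=> /andP[/andP[sFE acF] /eqP cC] /andP[cJ _].
  rewrite /completes sFE -port_graph_connected // cJ andbT /= -cardsT.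
  by rewrite (card_forest (network_proper sFE) acF) comps_network cC addnA.
have /andP[sfF /eqP cC] := completes_card sJ cFJ; rewrite sfF cC eqxx /=.
case/and3P: cFJ => sFE /eqP cV cFJ; rewrite -port_graph_connected // in cFJ.
have pJ := port_graph_proper F sJ.
rewrite /spanning_tree cFJ; apply: card_acyclic => //.
by rewrite (card_comps_connected pJ (components_neq0 F) cFJ) /= cC.
Qed.

(** The same trade in the quotient, whose vertex number is known from [card_quotient]. *)
Lemma validE F : valid E M P F = completes F N.
Proof.
have X0 : vertices (quotient_graph M P) != set0.
  by have /set0Pn[m _] := M_neq0; apply/set0Pn; exists (qv m); apply: imset_f.
apply/idP/idP => [/andP[/andP[sFE acF] /andP[cF acQ]] | cFN].
  have pF := quotient_proper sFE.
  rewrite /completes sFE -quotient_connected // cF andbT /= -card_quotient.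
  by rewrite (card_forest pF acQ) (card_comps_connected pF X0 cF) addnAC.
have /andP[sfF _] := completes_card (subxx _) cFN.
case/and3P: cFN => sFE /eqP cV cFN; rewrite -quotient_connected // in cFN.
have pF := quotient_proper sFE.
rewrite /valid sfF /spanning_tree cFN; apply: card_acyclic => //.
rewrite (card_comps_connected pF X0 cFN).
by rewrite -(leq_add2r #|N|) card_quotient -cV addnAC.
Qed.

(** The separate convention for the empty set is absorbed, as validity is the case where [J]
    consists of all ports. *)
Lemma PsiE (I : {set V}) : I \subset N ->
  Psi E c M P root I = \sum_(F | completes F (N :\: I)) weight c F.
Proof.
move=> sIN; rewrite /Psi; have [-> | I0] := eqVneq I set0.
  by rewrite setD0; apply: eq_bigl => F; apply: validE.
by apply: eq_bigl => F; rewrite -port_treeE ?subsetDl // cardsD (setIidPr sIN).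
Qed.

(** * Minors of the response form *)

Variable r0 : V.
Hypothesis r0_root : r0 = rt r0.
Hypothesis r0_M : r0 \in M.

(** The enumeration of the two ends orients each edge; [r0] is only the default of [nth]. *)
Let head (e : {set V}) := nth r0 (enum e) 1.
Let tail (e : {set V}) := nth r0 (enum e) 0.

Lemma edge_ends (e : {set V}) :
  e \in E -> e = [set head e; tail e] /\ head e != tail e.
Proof.
move/simpleE => ce; have := enum_uniq e; have := set_enum e.
rewrite /head /tail; have: size (enum e) = 2 by rewrite -cardE.
case: (enum e) => [|a [|b [|]]] //= _ <-; rewrite inE andbT => neq.
split; last by rewrite eq_sym.
by apply/setP=> x; rewrite !inE orbC.
Qed.

(** * The incidence matrix in the port coordinates *)

Section Incidence.
Variable A : comNzRingType.

(* The coefficient of z a in the potential of v. *)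
Definition lift (v a : V) : A := (v == a)%:R + ((v \in N) && (rt v == a))%:R.

Definition incidence (e : {set V}) (a : V) : A := lift (head e) a - lift (tail e) a.

Lemma sum_delta (v : V) (z : V -> A) : \sum_a (v == a)%:R * z a = z v.
Proof.
rewrite (bigD1 v) //= eqxx mul1r big1 ?addr0 // => a; rewrite eq_sym => /negPf->.
exact: mul0r.
Qed.

Lemma sum_lift (v : V) (z : V -> A) :
  \sum_a lift v a * z a = z v + (v \in N)%:R * z (rt v).
Proof.
under eq_bigr do rewrite mulrDl.
rewrite big_split sum_delta; congr (_ + _); case: (v \in N) => /=.
  by rewrite sum_delta mul1r.
by rewrite mul0r big1 // => a _; rewrite mul0r.
Qed.

Lemma sum_incidence (e : {set V}) (z : V -> A) :
  \sum_a incidence e a * z a =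
  \sum_a lift (head e) a * z a - \sum_a lift (tail e) a * z a.
Proof. by rewrite -sumrB; apply: eq_bigr => a _; rewrite mulrBl. Qed.

End Incidence.

(** Determinants can thus be computed over [int], where the only units are 1 and -1, and then mapped
    to the field. *)
Lemma incidence_int (A : comNzRingType) e a :
  incidence A e a = (incidence int e a)%:~R.
Proof. by rewrite /incidence /lift intrB !intrD !mulrz_nat. Qed.

(** * Squared determinants of square incidence matrices *)

Section TreeDeterminant.
Variables (m : nat) (h : 'I_m -> V) (F : {set {set V}}) (J : {set V}).
Hypothesis injh : injective h.
Hypothesis sJN : J \subset N.
Hypothesis imh : forall v, (v \in ~: (r0 |: J)) = (v \in codom h).
Hypothesis sFE : F \subset E.
Hypothesis cF : #|F| = m.

Let D : 'M[int]_m := \matrix_(i, j) incidence int (nth set0 (enum F) i) (h j).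

Let h_notin j : (h j != r0) /\ (h j \notin J).
Proof. by have := codom_f h j; rewrite -imh !inE negb_or => /andP. Qed.

(** Restricted to the columns listed by [h], [f] is an integral combination of the rows of [D]. *)
Let spanned (f : V -> int) :=
  exists a : 'rV[int]_m, forall j, f (h j) = (a *m D) 0 j.

Let spannedB f g : spanned f -> spanned g -> spanned (fun v => f v - g v).
Proof.
by move=> [a fE] [b gE]; exists (a - b) => j; rewrite fE gE mulmxBl !mxE.
Qed.

Let spanned_edge e : e \in F -> spanned (incidence int e).
Proof.
move=> Fe; have ltem : (index e (enum F) < m)%N.
  by rewrite -cF cardE index_mem mem_enum.
exists (delta_mx 0 (Ordinal ltem)) => j; rewrite -rowE !mxE nth_index //.
by rewrite mem_enum.
Qed.

Let spanned_ext f g : (forall j, f (h j) = g (h j)) -> spanned f -> spanned g.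
Proof. by move=> fg [a fE]; exists a => j; rewrite -fg. Qed.

Let spanned_lift v : connect (joined F J) r0 v -> spanned (lift int v).
Proof.
(* The column [r0] is left out, so [lift int r0] restricts to 0. *)
have s0 : spanned (lift int r0).
  exists 0 => j; rewrite mul0mx mxE /lift eq_sym.
  have [/negPf-> _] := h_notin j.
  by rewrite r0_root (negPf (root_of_portN r0_M)).
(* For the induction, [r0] is generalised to any start whose [lift] is spanned. *)
case/connectP=> p; move: (r0) s0 => x0 s0.
elim: p x0 s0 => [|y p IHp] x sx /=; first by move=> _ ->.
case/andP=> xy; apply: IHp; case/orP: xy => [/exists_inP[e Fe] | /exists_inP[z Jz]].
  have [eE neq] := edge_ends (subsetP sFE e Fe).
  rewrite /= {1}eE eq_set2 => /orP[]/andP[/eqP ex /eqP ey].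
    apply: spanned_ext (spannedB sx (spanned_edge Fe)) => j.
    by rewrite /incidence ex ey subKr.
  have s0' : spanned (fun=> 0) by exists 0 => j; rewrite mul0mx mxE.
  apply: spanned_ext (spannedB sx (spannedB s0' (spanned_edge Fe))) => j.
  by rewrite /incidence ex ey sub0r opprK addrC subrK.
(* The column [z] is left out too, so crossing the port edge of [z] changes nothing. *)
have eqz j : lift int z (h j) = lift int (rt z) (h j).
  have Nz := subsetP sJN z Jz; have Mz : z \in M by case/setDP: Nz.
  rewrite /lift Nz (negPf (root_of_portN Mz)) addr0.
  by case: eqP => [ez | _]; [have [_] := h_notin j; rewrite -ez Jz | rewrite add0r].
by case/orP=> /andP[/eqP ex /eqP ey]; apply: spanned_ext sx => j; rewrite ex ey eqz.
Qed.

Lemma det_incidence_sqr : (\det D) ^+ 2 = (joined_connected F J)%:R.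
Proof.
have [/forallP conF | disF] := boolP (joined_connected F J).
  have span1 j : exists a : 'rV[int]_m, a *m D = delta_mx 0 j.
    (* The unit vector at [h j] is the [lift] of [h j], minus that of its root if [h j] is a
       port. *)
    suff [a aE] : spanned (fun v => (h j == v)%:R).
      by exists a; apply/rowP=> k; rewrite -aE !mxE eqxx (inj_eq injh) eq_sym.
    have sh := spanned_lift (forallP (conF r0) (h j)).
    have [Nh | nNh] := boolP (h j \in N); last first.
      by apply: spanned_ext sh => k; rewrite /lift (negPf nNh) addr0.
    have Mh : h j \in M by case/setDP: Nh.
    have srt := spanned_lift (forallP (conF r0) (rt (h j))).
    apply: spanned_ext (spannedB sh srt) => k.
    by rewrite /lift Nh (negPf (root_of_portN Mh)) addr0 addrK.
  have [C CE] := fin_all_exists span1.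
  have : (\det (\matrix_i C i)) * \det D = 1.
    rewrite -det_mulmx -(det1 _ m); congr (\det _); apply/row_matrixP => i.
    by rewrite row_mul rowK CE row1.
  by move/intUnitRing.unitzPl => /orP[]/eqP->.
apply/eqP; rewrite expf_eq0 /= -det_tr; apply/det0P.
have [y nr0y] : exists y, ~~ connect (joined F J) r0 y.
  apply/existsP; rewrite -negb_forall; apply: contra disF => /forallP c0.
  apply/forallP=> x; apply/forallP=> y; apply: connect_trans (c0 y).
  by rewrite joined_sym.
pose U v : int := (~~ connect (joined F J) r0 v)%:R.
(* The port coordinates of the indicator [U]. *)
pose z a := U a - (a \in N)%:R * U (rt a).
have zE v : \sum_a lift int v a * z a = U v.
  rewrite sum_lift /z; case Nv: (v \in N); last by rewrite !mul0r subr0 addr0.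
  have Mv : v \in M by case/setDP: Nv.
  by rewrite (negPf (root_of_portN Mv)) !mul1r mul0r subr0 subrK.
have joinedU u v : joined F J u v -> U u = U v.
  move=> uv; rewrite /U; congr (~~ _)%:R; rewrite ![connect _ r0 _]joined_sym //.
  by apply: same_connect; [apply: joined_sym | apply: connect1].
(* [U] vanishes at [r0] and agrees at the two ends of each port edge of [J], so dropping the columns
   outside [h] loses nothing. *)
have z0 v : v \notin codom h -> z v = 0.
  rewrite -imh in_setC negbK in_setU1 => /predU1P[-> | Jv].
    rewrite /z {2}r0_root (negPf (root_of_portN r0_M)) mul0r subr0 /U.
    by rewrite connect0.
  have Nv := subsetP sJN v Jv.
  rewrite /z Nv mul1r (joinedU v (rt v)) ?subrr //.
  by apply/orP; right; apply/exists_inP; exists v; rewrite ?eqxx.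
have sum_h G : \sum_j G (h j) * z (h j) = \sum_a G a * z a.
  rewrite [RHS](bigID (mem (codom h))) /= [X in _ + X]big1 ?addr0; last first.
    by move=> a /z0->; rewrite mulr0.
  rewrite -(big_imset (fun a => G a * z a) (in2W injh)) /=.
  apply: eq_bigl => a; apply/imsetP/codomP => [[j _ ->] | [j ->]]; by exists j.
exists (\row_j z (h j)).
  apply: contraNneq nr0y => /rowP zh0.
  have : U y = 0.
    rewrite -zE -sum_h big1 // => j _.
    by have := zh0 j; rewrite !mxE => ->; rewrite mulr0.
  by rewrite /U; case: (connect _ r0 y).
apply/rowP=> i; rewrite !mxE; set e := nth set0 (enum F) i.
transitivity (\sum_j incidence int e (h j) * z (h j)).
  by apply: eq_bigr => j _; rewrite !mxE mulrC.
have Fe : e \in F by rewrite -mem_enum mem_nth // -cardE cF.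
rewrite sum_h sum_incidence !zE (joinedU (head e) (tail e)) ?subrr //.
apply/orP; left; apply/exists_inP; exists e => //=.
by apply/eqP; have [] := edge_ends (subsetP sFE e Fe).
Qed.

End TreeDeterminant.

(** * The Laplacian and the currents in the port coordinates *)

Hypothesis connE : connected (network_graph V) E.
Hypothesis c_gt0 : {in E, forall e, 0 < c e}.

(* The Laplacian in the coordinates z. *)
Definition response_form (a b : V) : R :=
  \sum_(e in E) c e * (incidence R e a * incidence R e b).

Lemma laplacian_edges u v :
  laplacian E c u v = \sum_(e in E)
    c e * (((head e == u)%:R - (tail e == u)%:R) *
           ((head e == v)%:R - (tail e == v)%:R)).
Proof.
rewrite /laplacian; case: ifP => [/eqP<- | /negbT neq].
  rewrite big_mkcondr; apply: eq_bigr => e /edge_ends[eE ht].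
  rewrite [in u \in e]eE !inE ![u == _]eq_sym.
  have [eh | _] /= := eqVneq (head e) u; have [et | _] /= := eqVneq (tail e) u.
  - by rewrite eh et eqxx in ht.
  - by rewrite subr0 !mulr1.
  - by rewrite sub0r mulrNN !mulr1.
  - by rewrite subrr !mulr0.
transitivity (\sum_(e in E) if e == [set u; v] then - c e else 0).
  rewrite -big_mkcondr /=; case: ifP => [Euv | nEuv].
    rewrite (big_pred1 [set u; v]) // => e; apply/andP/eqP => [[_ /eqP] // | ->].
    by rewrite Euv.
  by rewrite big_pred0 // => e; apply/andP => -[Ee /eqP eE]; rewrite eE nEuv in Ee.
apply: eq_bigr => e /edge_ends[eE ht].
rewrite [in e == _]eE eq_set2 ![u == _]eq_sym ![v == _]eq_sym.
have [eh | _] /= := eqVneq (head e) u.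
  rewrite -eh [tail e == head e]eq_sym (negPf ht) subr0 mul1r.
  rewrite eh (negPf neq) sub0r andbF orbF /=.
  by case: (_ == _); rewrite /= ?mulrN1 ?oppr0 ?mulr0.
have [et | _] /= := eqVneq (tail e) u; last by rewrite subrr mul0r mulr0.
rewrite et (negPf neq) subr0 sub0r mulN1r.
by case: (_ == _); rewrite /= ?mulrN1 ?oppr0 ?mulr0.
Qed.

Lemma current_edges (U : V -> R) u : current E c U u = \sum_(e in E)
  c e * (((head e == u)%:R - (tail e == u)%:R) * (U (head e) - U (tail e))).
Proof.
rewrite /current; under eq_bigr do rewrite laplacian_edges mulr_suml.
rewrite exchange_big; apply: eq_bigr => e _ /=.
under eq_bigr do rewrite -!mulrA [X in _ * (_ * X)]mulrBl.
by rewrite -!mulr_sumr sumrB !sum_delta.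
Qed.

(** Summation by parts, the discrete Green identity; for constant [f] it says that the total current
    is 0. *)
Lemma sum_current_weighted (U f : V -> R) : \sum_u f u * current E c U u =
  \sum_(e in E) c e * ((f (head e) - f (tail e)) * (U (head e) - U (tail e))).
Proof.
under eq_bigr do rewrite current_edges mulr_sumr.
rewrite exchange_big; apply: eq_bigr => e _ /=.
under eq_bigr => u _ do rewrite mulrCA [f u * _]mulrA [f u * _]mulrC mulrBl.
by rewrite -mulr_sumr -mulr_suml sumrB !sum_delta.
Qed.

(** The form is T^t L T with L the Laplacian and T the matrix [lift]; [U] is the potential T z. *)
Lemma response_formE (z : V -> R) a (U := fun v => \sum_b lift R v b * z b) :
  \sum_b response_form a b * z b = \sum_u lift R u a * current E c U u.
Proof.
rewrite sum_current_weighted; under eq_bigr do rewrite mulr_suml.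
rewrite exchange_big; apply: eq_bigr => e _ /=.
rewrite -sum_incidence !mulr_sumr; apply: eq_bigr => b _.
by rewrite !mulrA.
Qed.

(** Such an [a] is not the root of any port, so column [a] of [lift] is a unit vector. *)
Lemma current_form (z : V -> R) a (U := fun v => \sum_b lift R v b * z b) :
  (a \notin M) || (a \in N) -> \sum_b response_form a b * z b = current E c U a.
Proof.
move=> Ha; rewrite response_formE -/U (bigD1 a) //= {1}/lift eqxx.
have no u : (u \in N) && (rt u == a) = false.
  apply/negP => /andP[/setDP[Mu _] /eqP eu]; move: Ha; rewrite -eu.
  by rewrite root_of_boundary ?(negPf (root_of_portN Mu)).
rewrite no addr0 mul1r big1 ?addr0 // => u /negPf nu.
by rewrite /lift nu no addr0 mul0r.
Qed.

(** Raising the coordinate of a root raises its whole superport: column [root B] of [lift] is the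
    indicator of [B]. *)
Lemma block_current_form (z : V -> R) B (U := fun v => \sum_b lift R v b * z b) :
  B \in P ->
  \sum_b response_form (root B) b * z b = \sum_(v in B) current E c U v.
Proof.
move=> PB; rewrite response_formE -/U [RHS]big_mkcond /=; apply: eq_bigr => u _.
suff -> : lift R u (root B) = (u \in B)%:R.
  by case: (u \in B); rewrite ?mul1r ?mul0r.
have [Bu | nBu] := boolP (u \in B).
  have rtu : rt u = root B by rewrite /root_of (pblock_block PB Bu).
  rewrite /lift portE rtu eqxx andbT (block_boundary PB Bu) /=.
  by case: (u == root B); rewrite ?addr0 ?add0r.
rewrite /lift; case: eqP => [eu | _]; first by rewrite eu rootP in nBu.
case: andP => [[/setDP[Mu _] /eqP eu] | _]; last by rewrite addr0.
have := root_of_mem Mu; rewrite eu => bu.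
case/negP: nBu; rewrite -(pblock_block PB (rootP PB)) (pblock_block (pblockP Mu) bu).
by rewrite mem_pblock (cover_partition partP).
Qed.

(* Its determinant is the minor of [response_form] on the vertices that are
   neither r0 nor a port outside I, see [fdet_rows]. *)
Definition pinned_form (I : {set V}) (u v : V) : R :=
  if u \in ~: (r0 |: N :\: I) then response_form u v else (u == v)%:R.

Lemma fdet_pinned (I : {set V}) : I \subset N ->
  fdet (pinned_form I) = Psi E c M P root I.
Proof.
move=> sIN; rewrite PsiE //; set J := N :\: I.
have sJN : J \subset N by apply: subsetDl.
pose S := ~: (r0 |: J); pose m := #|S|.
pose h (i : 'I_m) : V := enum_val i.
have injh : injective h by apply: enum_val_inj.
have imh v : (v \in S) = (v \in codom h).
  apply/idP/codomP => [Sv | [i ->]]; last exact: enum_valP.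
  by exists (enum_rank_in Sv v); rewrite /h enum_rankK_in.
have cS : (m + #|J| + 1 = #|V|)%N.
  rewrite /m -addnA addn1 -(cardsC S) setCK cardsU1.
  have -> : r0 \notin J by rewrite inE negb_and r0_root root_of_portN ?orbT.
  by rewrite add1n.
rewrite (fdet_rows _ injh imh).
(* Extension by 0 lets Cauchy-Binet run over all sets of pairs; those not contained in [E]
   contribute 0. *)
pose cE e := if e \in E then c e else 0.
pose D (F : {set {set V}}) : 'M[R]_m :=
  \matrix_(i, j) incidence R (nth set0 (enum F) i) (h j).
transitivity (\det (\matrix_(i < m, j < m)
    \sum_e (cE e * incidence R e (h i)) * incidence R e (h j))).
  congr (\det _); apply/matrixP => i j; rewrite !mxE /response_form big_mkcond.
  by apply: eq_bigr => e _; rewrite /cE; case: ifP; rewrite ?mul0r // mulrA.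
rewrite (Cauchy_Binet set0 (fun i e => cE e * incidence R e (h i))).
rewrite big_mkcond [RHS]big_mkcond; apply: eq_bigr => F _ /=.
(* By [cS] the size condition of Cauchy-Binet is the counting clause of [completes]. *)
rewrite /completes -cS !eqn_add2r; case: eqP => [cF | _]; last by rewrite andbF.
rewrite /=.
have -> : \matrix_(i < m, j < m)
    (cE (nth set0 (enum F) j) * incidence R (nth set0 (enum F) j) (h i)) =
    (D F)^T *m diag_mx (\row_j cE (nth set0 (enum F) j)).
  by apply/matrixP=> i j; rewrite mul_mx_diag !mxE mulrC.
rewrite det_mulmx det_tr det_diag mulrAC -/(D F) -expr2.
under eq_bigr do rewrite mxE.
have -> : \prod_(i < m) cE (nth set0 (enum F) i) = \prod_(e in F) cE e.
  by rewrite -[RHS]big_enum [RHS](big_nth set0) -cardE cF big_mkord.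
have detD : \det (D F) =
    (\det (\matrix_(i < m, j < m)
       incidence int (nth set0 (enum F) i) (h j)))%:~R.
  rewrite -det_map_mx; congr (\det _); apply/matrixP=> i j.
  by rewrite !mxE incidence_int.
case: ifP => [/andP[sFE conF] | /negbT].
  rewrite detD -rmorphXn /= (det_incidence_sqr injh sJN imh sFE cF) conF mul1r.
  by apply: eq_bigr => e Fe; rewrite /cE (subsetP sFE e Fe).
rewrite negb_and => nF; have [sFE | /subsetPn[e Fe nEe]] := boolP (F \subset E).
  rewrite sFE /= in nF.
  by rewrite detD -rmorphXn /= (det_incidence_sqr injh sJN imh sFE cF) (negPf nF) mul0r.
have -> : \prod_(e in F) cE e = 0 by rewrite (bigD1 e) //= /cE (negPf nEe) mul0r.
by rewrite mulr0.
Qed.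

(** * The response matrix as a Schur complement *)

Variables (q : nat) (xs : q.-tuple V).
Hypothesis uniq_xs : uniq xs.
Hypothesis mem_xs : xs =i N.

(** The rows of the pinned system ground [r0], prescribe the port voltages [y], and cancel the
    current off the boundary and the total current of every superport but that of [r0]. *)
Lemma pinned_kernel (z y : V -> R) (U := fun v => \sum_b lift R v b * z b) :
    (forall u, \sum_v pinned_form set0 u v * z v = ((u \in N)%:R * y u)) ->
  [/\ z r0 = 0, {in N, z =1 y}
    & admissible E c M P root xs (\col_i y (tnth xs i)) U].
Proof.
move=> zE.
have pin u : u \notin ~: (r0 |: N :\: set0) -> z u = (u \in N)%:R * y u.
  by rewrite -zE /pinned_form => /negPf->; rewrite sum_delta.
have free u : u \in ~: (r0 |: N) -> \sum_b response_form u b * z b = 0.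
  rewrite inE => Su; rewrite -[RHS](mul0r (y u)).
  have /negPf nNu : u \notin N by move: Su; rewrite in_setU1 negb_or => /andP[].
  by have := zE u; rewrite nNu /pinned_form setD0 in_setC Su.
have nNr0 : r0 \notin N by rewrite r0_root root_of_portN.
have zN : {in N, z =1 y}.
  by move=> u Nu; rewrite pin ?Nu ?mul1r // setD0 in_setC negbK in_setU1 Nu orbT.
have out v : v \notin M -> current E c U v = 0.
  move=> nMv; rewrite -current_form ?nMv // free // in_setC in_setU1 negb_or.
  by rewrite portE (negPf nMv) andbT; apply: contraNneq nMv => ->.
have sumA A : A \in P -> root A != r0 -> \sum_(v in A) current E c U v = 0.
  move=> PA nr; rewrite -block_current_form // free // in_setC in_setU1 negb_or nr.
  by rewrite -(root_of_root PA) root_of_portN // (block_boundary PA (rootP PA)).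
split=> //; first by rewrite pin ?(negPf nNr0) ?mul0r // setD0 in_setC negbK setU11.
split=> // [i | A PA].
  have Nx : tnth xs i \in N by rewrite -mem_xs mem_tnth.
  have Mx : tnth xs i \in M by case/setDP: Nx.
  rewrite /U !sum_lift Nx (negPf (root_of_portN Mx)) mul0r addr0 mul1r addrK mxE.
  exact: zN.
(* The remaining superport is balanced because all currents add up to 0. *)
have [eqr | /sumA] := eqVneq (root A) r0; last exact.
have : \sum_v 1 * current E c U v = 0.
  by rewrite sum_current_weighted big1 // => e _; rewrite subrr mul0r mulr0.
under eq_bigr do rewrite mul1r.
rewrite (bigID (mem M)) /= addrC big1 // add0r.
rewrite -{1}(cover_partition partP) big_trivIset; last by case/and3P: partP.
rewrite /= (bigD1 A) //= [X in _ + X]big1 ?addr0 // => B /andP[PB neB].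
apply: sumA => //; apply: contraNneq neB => eqB.
by rewrite -(pblock_block PB (rootP PB)) eqB -eqr (pblock_block PA (rootP PA)).
Qed.

(** Let [z] be the inverse of [pinned_form set0]. In the product of [pinned_form I] and [z] the rows
    outside [I] are identity rows, and the block on [I] is the principal submatrix of [L]. *)
Lemma det_response (L : 'M[R]_q) (I : {set V}) : I \subset N ->
  superport_response E c M P root xs L ->
  \det (principal_submx xs L I) = fdet (pinned_form I) / fdet (pinned_form set0).
Proof.
move=> sIN LP.
have ker0 (z : V -> R) :
    (forall u, \sum_v pinned_form set0 u v * z v = 0) -> z =1 (fun=> 0).
  move=> z0; pose U v := \sum_b lift R v b * z b.
  have [zr0 zN admU] : [/\ z r0 = 0, {in N, z =1 fun=> 0}
      & admissible E c M P root xs (\col_i 0) U].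
    by apply: pinned_kernel => u; rewrite z0 mulr0.
  have Uz v : U v = z v + (v \in N)%:R * z (rt v) by apply: sum_lift.
  (* Zero port voltages force a constant potential, and [r0] is grounded. *)
  have U0 v : U v = 0.
    have -> : U v = U r0.
      apply: (admissible0 simpleE connE c_gt0 partP rootP mem_xs (U := U)).
      by have -> : 0 = \col_i 0 :> 'cV[R]_q by apply/colP=> i; rewrite !mxE.
    by rewrite Uz zr0 r0_root (negPf (root_of_portN r0_M)) mul0r addr0.
  move=> v; have [/zN // | nNv] := boolP (v \in N).
  by have := U0 v; rewrite Uz (negPf nNv) mul0r addr0.
have [z zE] := fdet_inverse ker0.
have det1z : fdet (pinned_form set0) * fdet z = 1.
  by rewrite fdet_mul -[RHS](fdet_delta R V); apply: eq_fdet.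
suff detIz : fdet (pinned_form I) * fdet z = \det (principal_submx xs L I).
  have nz : fdet (pinned_form set0) != 0.
    by apply: contra_eq_neq det1z => ->; rewrite mul0r eq_sym oner_eq0.
  by apply: (mulIf nz); rewrite divfK // -detIz mulrAC -mulrA det1z mulr1.
pose h (i : 'I_#|port_indices xs I|) := tnth xs (enum_val i).
have injh : injective h by move=> i j /(tuple_uniqP xs uniq_xs)/enum_val_inj.
have imh v : (v \in I) = (v \in codom h).
  apply/idP/codomP => [Iv | [i ->]]; last by have := enum_valP i; rewrite inE.
  have: v \in xs by rewrite mem_xs (subsetP sIN).
  case/tnthP=> k def_v; have Ik : k \in port_indices xs I by rewrite inE -def_v.
  by exists (enum_rank_in Ik k); rewrite /h enum_rankK_in.
have IN j : h j \in N by rewrite (subsetP sIN) // imh codom_f.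
(* Outside [I] the forms pinned for [I] and for [set0] have the same rows. *)
transitivity (fdet (fun u v => if u \in I then \sum_w response_form u w * z w v
                               else (u == v)%:R)).
  rewrite fdet_mul; apply: eq_fdet => u v; case: ifP => [Iu | nIu].
    apply: eq_bigr => w _; rewrite /pinned_form ifT //.
    rewrite in_setC in_setU1 negb_or in_setD Iu andbT.
    by apply: contraTneq (subsetP sIN u Iu) => ->; rewrite r0_root root_of_portN.
  rewrite -zE; apply: eq_bigr => w _; rewrite /pinned_form setD0.
  by rewrite !in_setC !in_setU1 in_setD nIu.
rewrite (fdet_rows _ injh imh); congr (\det _); apply/matrixP => i j; rewrite !mxE.
(* Column [h j] of [z] solves the network problem with unit voltage at the port [h j], so its
   currents form a column of [L]. *)
pose y u : R := (u == h j)%:R; pose U v := \sum_b lift R v b * z b (h j).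
have [_ _ admU] : [/\ z r0 (h j) = 0, {in N, z^~ (h j) =1 y}
    & admissible E c M P root xs (\col_i y (tnth xs i)) U].
  apply: pinned_kernel => u; rewrite zE /y.
  by case: eqP => [-> | _]; rewrite ?IN ?mul1r ?mulr0.
rewrite (current_form (fun b => z b (h j))) ?IN ?orbT // -/U.
have /colP/(_ (enum_val i)) :
    \col_k current E c U (tnth xs k) = L *m \col_k y (tnth xs k).
  by apply/LP; exists U.
rewrite !mxE => ->; rewrite (bigD1 (enum_val j)) //= mxE /y eqxx mulr1.
rewrite big1 ?addr0 // => k nk.
by rewrite mxE (inj_eq (tuple_uniqP xs uniq_xs)) (negPf nk) mulr0.
Qed.

End Forests.

Theorem corollary5p3 (R : realFieldType) (V : finType)
    (E : {set {set V}}) (c : {set V} -> R)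
    (M : {set V}) (P : {set {set V}}) (root : {set V} -> V)
    (q : nat) (xs : q.-tuple V) (L : 'M[R]_q) (I : {set V}) :
  simple_graph E ->
  connected (network_graph V) E ->
  {in E, forall e, 0 < c e} ->
  M != set0 ->
  partition P M ->
  {in P, forall A : {set V}, root A \in A} ->
  uniq xs -> xs =i ports M P root ->
  superport_response E c M P root xs L ->
  I \subset ports M P root ->
  \det (principal_submx xs L I) = Psi E c M P root I / Phi_valid E c M P.
Proof.
move=> simpleE connE c_gt0 M0 partP rootP uniq_xs mem_xs LP sIN.
(* Any root serves as ground; one exists because the boundary is nonempty. *)
have /set0Pn[m0 Mm0] := M0; pose r0 := root_of P root m0.
have r0_root : r0 = root_of P root r0.
  by rewrite [RHS](root_of_root partP rootP) // (pblockP partP).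
have r0_M : r0 \in M by apply: root_of_boundary.
rewrite (det_response simpleE partP rootP r0_root r0_M connE c_gt0 uniq_xs mem_xs
  sIN LP).
rewrite !(fdet_pinned c simpleE M0 partP rootP r0_root r0_M) ?sub0set //.
by rewrite {2}/Psi eqxx.
Qed.
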